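(* Consider the linear controlled stochastic system $$dX(t)=(AX(t)+Bu)\,dt+C\,dW_t,\qquad X(0)=x_0\in\mathbb{R}^n,$$ where $A$ is an $n\times n$ matrix, $B$ is an $n\times n$ matrix of full rank, and $C$ is an $n\times m$ matrix (all real and constant). Assume that there exists a Hurwitz matrix $D\in\mathbb{R}^{n\times n}$ such that the pair $(D,C)$ is completely disturbable, i.e. $\operatorname{rank}(C\,|\,DC\,|\cdots|\,D^{n-1}C)=n$. Let $\delta>0$ and $B_\delta=\{x\in\mathbb{R}^n:|x|<\delta\}$. Then for any $T>0$ and $0<p<1$, the system is residence probability controllable outside $B_\delta$ for any initial value $x_0\in B_\delta^c$: for every $x_0\in B_\delta^c$ there exists an admissible Markov control $u=u(t,X(t))$ such that the solution of the closed-loop system satisfies $$\mathbb{P}^{x_0}\big(\exists\,t\in[0,T]:\ X(t)\in\partial B_\delta\big)\ge p.$$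
   Context: $W$ is a standard $\mathbb{R}^m$-valued Brownian motion on a complete filtered probability space satisfying the usual conditions; $|\cdot|$ is the Euclidean norm; $\partial B_\delta$ and $B_\delta^c$ denote boundary and complement; $\mathbb{P}^{x_0}$ is the law of the closed-loop solution with $X(0)=x_0$. A real square matrix is Hurwitz if all its eigenvalues have negative real part. A Markov control is one of the form $u(t)=u(t,X(t))$ with $u:\mathbb{R}_+\times\mathbb{R}^n\to\mathbb{R}^n$; it is admissible if the resulting closed-loop equation has a unique global solution (no explosion). *)

(* Defs.v *)
From HB Require Import structures.
From mathcomp Require Import all_boot all_order all_algebra.
From mathcomp Require Import complex.
From mathcomp Require Import all_classical all_reals all_analysis.

Set Implicit Arguments.
Unset Strict Implicit.
Unset Printing Implicit Defensive.
Import Order.TTheory GRing.Theory Num.Theory.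
Import numFieldNormedType.Exports.
Local Open Scope classical_set_scope.
Local Open Scope ring_scope.

(* R^n is 'cV[R]_n. The library norm on matrices is the sup norm, hence the
   explicit Euclidean norm; the topologies agree. *)
Definition enorm (R : realType) (n : nat) (x : 'cV[R]_n) : R :=
  Num.sqrt (\sum_(i < n) x i ord0 ^+ 2).

Definition eball0 (R : realType) (n : nat) (delta : R) : set 'cV[R]_n :=
  [set x | enorm x < delta].
Arguments eball0 {R} n delta.

Definition boundary (T : topologicalType) (S : set T) : set T :=
  closure S `\` interior S.

Definition borel (T : topologicalType) : set (set T) := <<s (@open T) >>.
Arguments borel : clear implicits.

Definition hurwitz (R : realType) (n : nat) (D : 'M[R]_n) : Prop :=
  forall z : complex R,
    eigenvalue (map_mx (real_complex R) D) z -> complex.Re z < 0.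

Definition completely_disturbable (R : realType) (n m : nat)
    (D : 'M[R]_n) (C : 'M[R]_(n, m)) : Prop :=
  \rank (\mxrow_(j < n) (D ^+ j *m C)) = n.

(* A process is a map R -> Omega -> E of which only the times t >= 0 matter;
   likewise for filtrations. *)
Record usual_filtration (R : realType) (d : measure_display)
    (Omega : measurableType d) (P : probability Omega R)
    (F : R -> set (set Omega)) : Prop := UsualFiltration {
  usual_complete : measure_is_complete P ;
  usual_sigma_algebra : forall t : R, 0 <= t -> sigma_algebra setT (F t) ;
  usual_measurable : forall t : R, 0 <= t -> F t `<=` measurable ;
  usual_nondecreasing : forall s t : R, 0 <= s -> s <= t -> F s `<=` F t ;
  usual_right_continuous : forall t : R, 0 <= t ->
    \bigcap_(s in [set s | t < s]) F s = F t ;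
  usual_null_sets : P.-negligible `<=` F 0
}.

Definition adapted (R : realType) (Omega : Type) (E : topologicalType)
    (F : R -> set (set Omega)) (X : R -> Omega -> E) : Prop :=
  forall t : R, 0 <= t -> forall S, borel E S -> F t (X t @^-1` S).

(* Standard m-dimensional Brownian motion relative to F: W_t - W_s is
   independent of F_s with law N(0, (t - s) I_m), the latter being the product
   of m copies of N(0, t - s) and hence determined by its values on boxes.
   normal_prob takes the standard deviation as its second parameter. *)
Record brownian_motion (R : realType) (d : measure_display)
    (Omega : measurableType d) (P : probability Omega R)
    (F : R -> set (set Omega)) (m : nat) (W : R -> Omega -> 'cV[R]_m) : Prop :=
  BrownianMotion {
  brownian_adapted : adapted F W ;
  brownian_start : {ae P, forall w, W 0 w = 0} ;
  brownian_continuous :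
    {ae P, forall w, {within `[0, +oo[, continuous (W ^~ w)}} ;
  brownian_independent : forall s t : R, 0 <= s -> s < t ->
    forall G S, F s G -> borel 'cV[R]_m S ->
    P (G `&` [set w | S (W t w - W s w)]) =
      (P G * P [set w | S (W t w - W s w)%R])%E ;
  brownian_normal : forall s t : R, 0 <= s -> s < t ->
    forall S : 'I_m -> set (measurableTypeR R), (forall i, measurable (S i)) ->
    P [set w | forall i, S i ((W t w - W s w) i ord0)] =
      (\prod_(i < m) normal_prob 0%R (Num.sqrt (t - s)%R) (S i))%E
}.

Section closed_loop.
Variables (R : realType) (d : measure_display) (Omega : measurableType d).
Variables (P : probability Omega R) (F : R -> set (set Omega)) (n m : nat).
Variables (W : R -> Omega -> 'cV[R]_m).
Variables (A B : 'M[R]_n) (C : 'M[R]_(n, m)).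

Definition drift (u : R -> 'cV[R]_n -> 'cV[R]_n) (s : R) (x : 'cV[R]_n) :
    'cV[R]_n :=
  A *m x + B *m u s x.

(* Global strong solution of dX = (A X + B u(t, X)) dt + C dW, X(0) = x0, in
   integral form. Since C is constant, the stochastic integral of C against W
   over [0, t] is C (W_t - W_0). *)
Definition closed_loop_solution (u : R -> 'cV[R]_n -> 'cV[R]_n)
    (x0 : 'cV[R]_n) (X : R -> Omega -> 'cV[R]_n) : Prop :=
  adapted F X /\
  {ae P, forall w,
    [/\ X 0 w = x0,
        {within `[0, +oo[, continuous (X ^~ w)},
        forall (t : R) (i : 'I_n), 0 <= t -> lebesgue_measure.-integrable `[0, t]
          (EFin \o (fun s => drift u s (X s w) i ord0)) &
        forall t : R, 0 <= t ->
          X t w = x0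
            + \col_(i < n) (\int[lebesgue_measure]_(s in `[0, t])
                              drift u s (X s w) i ord0)
            + C *m (W t w - W 0 w)]}.

(* Markov control laws are taken to be Borel on [0, +oo[ x R^n, and existence
   and pathwise uniqueness are required from every deterministic initial
   value. *)
Definition admissible (u : R -> 'cV[R]_n -> 'cV[R]_n) : Prop :=
  (forall S, borel 'cV[R]_n S ->
     borel (R * 'cV[R]_n)%type [set tx | 0 <= tx.1 /\ S (u tx.1 tx.2)]) /\
  forall x0,
    (exists X, closed_loop_solution u x0 X) /\
    (forall X Y, closed_loop_solution u x0 X -> closed_loop_solution u x0 Y ->
       {ae P, forall w, forall t : R, 0 <= t -> X t w = Y t w}).

End closed_loop.

(* Main.v *)
Require Import Defs.
From mathcomp Require Import all_boot all_order all_algebra.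
From mathcomp Require Import complex.
From mathcomp Require Import all_classical all_reals all_analysis.
From mathcomp Require Import measurable_realfun ring lra.
Set Implicit Arguments.
Unset Strict Implicit.
Unset Printing Implicit Defensive.
Import Order.TTheory GRing.Theory Num.Theory.
Import numFieldNormedType.Exports.
Local Open Scope classical_set_scope.
Local Open Scope ring_scope.

(* The full-rank B allows the feedback B u = -k X - A X, which turns the
   closed loop into dX = -k X dt + C dW. As the noise is additive, this equation
   is solved path by path, coordinate by coordinate: with g = x0 + C (W - W_0),
   X_t = g(t) - k exp(-k t) \int_0^t exp(k s) g(s) ds. For each continuous path
   the exponential kernel concentrates at s = t as k tends to infinity, so that
   X_T tends to 0 surely, hence |X_T| < delta with probability at least p once k
   is large; the intermediate value theorem then gives a hitting time. *)

(** The formula for X_t is variation of constants with the integral of exp(-k (t - s)) against dW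
    integrated by parts, so that no stochastic integral has to be constructed. The gain k that
    brings X_T into the ball depends on the path; one gain serving a set of paths of probability at
    least p comes from continuity of P along increasing events. The other obstacle is measurability:
    the hitting event is a union over uncountably many times, and it is required for every solution.
    It is proved for the explicit process, which has all its paths continuous, and carried over to
    any other solution by pathwise uniqueness and completeness of P. Paths matter only for t >= 0;
    precomposing them with max(t, 0) makes them continuous on the whole line, so that two-sided
    derivatives are available at 0 as well. *)

(** * Calculus on the half-line *)

Lemma continuous_max0 (R : realType) (T : topologicalType) (f : R -> T) :
  {within `[0, +oo[, continuous f} <-> continuous (fun t : R => f (Num.max t 0)).
Proof.
split=> cf.
  move=> t; have m0 : `[0, +oo[%classic (Num.max t 0).
    by rewrite /= in_itv /= andbT le_max lexx orbT.
  have ct : Num.max s 0 @[s --> t] --> Num.max t 0.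
    apply: (@continuous_max R R id (cst 0) t); first exact: id.
    exact: cst_continuous.
  move=> U /= /(cf (Num.max t 0)) /= fU.
  have {}fU : within `[0, +oo[ (nbhs (Num.max t 0)) (f @^-1` U).
    by rewrite (nbhs_subspace_in m0).
  apply: (@filterS _ (nbhs t) _ _ _ _ (ct _ fU)) => s /=; apply.
  by rewrite /= in_itv /= andbT le_max lexx orbT.
apply: (@subspace_eq_continuous _ _ _ (fun t : R => f (Num.max t 0))).
  move=> t; rewrite inE /= in_itv /= andbT => t0; by rewrite max_l.
exact: continuous_subspaceT.
Qed.

(** Packages the fundamental theorem of calculus: later proofs differentiate F, also at 0, instead
    of handling integrals with a variable endpoint. The last clause is confined to t >= 0 because
    [[0, t]] is empty for negative t. *)
Lemma antiderivative (R : realType) (f : R -> R) : continuous f ->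
  exists F : R -> R, [/\ forall t : R, -1 < t -> is_derive t 1 F (f t),
    F 0 = 0 & forall t : R, 0 <= t ->
    (\int[lebesgue_measure]_(s in `[0, t]) f s) = F t].
Proof.
move=> cf.
have fi (a b : R) : lebesgue_measure.-integrable `[a, b] (EFin \o f).
  apply: continuous_compact_integrable; first exact: segment_compact.
  exact: continuous_subspaceT.
(* Starting at -1 makes 0 an interior point. *)
pose G (t : R) := \int[lebesgue_measure]_(s in `[-1, t]) f s.
have dG (t : R) : -1 < t -> is_derive t 1 G (f t).
  move=> t1.
  have [dG <-] := @continuous_FTC1_closed R f (-1) t (t + 1) ltac:(lra)
    (fi _ _) t1 (cf t).
  by rewrite derive1E; exact: derivableP.
have dF (t : R) : -1 < t -> is_derive t 1 (fun t : R => G t - G 0) (f t).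
  move=> t1; rewrite -[f t]subr0; have := dG t t1 => ?.
  exact: is_deriveB.
exists (fun t : R => G t - G 0); split => //; first by rewrite subrr.
move=> t; rewrite le_eqVlt => /predU1P[<-|t0].
  by rewrite set_itv1 Rintegral_set1 subrr.
rewrite /Rintegral (@continuous_FTC2 _ f (fun t : R => G t - G 0)) //=.
- by rewrite subrr subr0.
- exact: continuous_subspaceT.
- have c (s : R) : -1 < s -> {for s, continuous (fun t : R => G t - G 0)}.
    move=> s1; apply: differentiable_continuous.
    by apply/derivable1_diffP; have [] := dF s s1.
  split.
  + move=> s; rewrite in_itv /= => /andP[s0 _].
    by have [] := dF s ltac:(lra).
  + by apply: cvg_at_right_filter; apply: c; lra.
  + by apply: cvg_at_left_filter; apply: c; lra.
- move=> s; rewrite in_itv /= => /andP[s0 _].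
  rewrite derive1E; have := dF s ltac:(lra) => ?; exact: derive_val.
Qed.

(** * The pathwise linear equation: solution, uniqueness, limit of large gain *)

(** The factor exp(-k t) of the convolution kernel stands outside the integral, so that the
    integrand does not depend on t and the integral has an antiderivative in t. *)
Definition ou (R : realType) (k : R) (g : R -> R) (t : R) : R :=
  g t - k * expR (- k * t) *
    \int[lebesgue_measure]_(s in `[0, t]) (expR (k * s) * g s).

Lemma continuous_scale (R : realType) (c : R) (f : R -> R) :
  continuous f -> continuous (fun t : R => c * f t).
Proof. by move=> cf t; apply: cvgM; [exact: cvg_cst|exact: cf]. Qed.

Lemma continuous_expRM (R : realType) (k : R) :
  continuous (fun t : R => expR (k * t)).
Proof.
move=> t; apply: (@continuous_comp _ _ _ (fun t : R => k * t) expR).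
  by apply: cvgMr; exact: cvg_id.
exact: continuous_expR.
Qed.

Lemma ou_integrand_continuous (R : realType) (k : R) (g : R -> R) :
  continuous g -> continuous (fun s : R => expR (k * s) * g s).
Proof. by move=> cg t; apply: cvgM; [exact: continuous_expRM|exact: cg]. Qed.

Lemma is_derive_expRM (R : realType) (k t : R) :
  is_derive t 1 (fun s : R => expR (k * s)) (k * expR (k * t)).
Proof.
have -> : k * expR (k * t) = expR (k * t) * (k *: 1) by rewrite [k *: 1]mulr1 mulrC.
exact: (@is_derive1_comp _ expR (fun s : R => k * s) t _ _).
Qed.

Lemma is_derive_continuous (R : realType) (F : R -> R) (t l : R) :
  is_derive t 1 F l -> {for t, continuous F}.
Proof.
by move=> [dF _]; apply: differentiable_continuous; exact/derivable1_diffP.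
Qed.

Lemma within_continuous_derive (R : realType) (F f : R -> R) (a b : R) :
  (forall s : R, a <= s -> is_derive s 1 F (f s)) ->
  {within `[a, b], continuous F}.
Proof.
move=> dF; apply: continuous_in_subspaceT => s; rewrite inE /= in_itv /=.
by move=> /andP[/dF/is_derive_continuous].
Qed.

Lemma derive0_eq (R : realType) (F : R -> R) (t : R) :
  (forall s : R, 0 <= s -> is_derive s 1 F 0) -> 0 <= t -> F t = F 0.
Proof.
move=> dF t0; apply/eqP; rewrite -subr_eq0.
have [||c _ ->] := @MVT_segment R F (fun=> 0) 0 t t0; last by rewrite mul0r.
  by move=> s; rewrite in_itv /= => /andP[/ltW s0 _]; exact: dF.
exact: within_continuous_derive.
Qed.

Lemma ou_max0_continuous (R : realType) (k : R) (g : R -> R) :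
  continuous g -> continuous (fun t : R => ou k g (Num.max t 0)).
Proof.
move=> cg.
have [F [dF F0 FE]] := antiderivative (@ou_integrand_continuous R k g cg).
have -> : (fun t : R => ou k g (Num.max t 0)) =
   (fun t : R => g t - k * expR (- k * t) * F t) \o (fun t : R => Num.max t 0).
  by apply/funext => t /=; rewrite /ou FE// le_max lexx orbT.
move=> t; apply: continuous_comp.
  by apply: (@continuous_max R R id (cst 0) t) => //; exact: cst_continuous.
apply: cvgB; first exact: cg.
apply: cvgM.
  by apply: cvgMr; exact: continuous_expRM.
apply: is_derive_continuous; apply: dF.
by rewrite (lt_le_trans (@ltrN10 _))// le_max lexx orbT.
Qed.

(** Let F and H be the antiderivatives of exp(k s) g(s) and of -k [ou k g], both vanishing at 0.
    Once g is cancelled, the claim is H(t) = -k exp(-k t) F(t), and the difference Q of the two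
    sides has derivative zero. *)
Lemma ou_eq (R : realType) (k : R) (g : R -> R) (t : R) :
  continuous g -> 0 <= t ->
  ou k g t = g t + \int[lebesgue_measure]_(s in `[0, t]) (- k * ou k g s).
Proof.
move=> cg t0.
have [F [dF F0 FE]] := antiderivative (@ou_integrand_continuous R k g cg).
have [H [dH H0 HE]] := antiderivative
  (@continuous_scale R (- k) _ (@ou_max0_continuous R k g cg)).
have -> : \int[lebesgue_measure]_(s in `[0, t]) (- k * ou k g s) =
    \int[lebesgue_measure]_(s in `[0, t]) (- k * ou k g (Num.max s 0)).
  apply: eq_Rintegral => s; rewrite inE /= in_itv /= => /andP[s0 _].
  by rewrite max_l.
rewrite HE// /ou FE//; congr (_ + _).
pose Q (s : R) := H s + k * (expR (- k * s) * F s).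
suff : Q t = Q 0.
  by rewrite /Q H0 F0 !mulr0 addr0 -mulrA => /eqP; rewrite addr_eq0 => /eqP ->.
apply: derive0_eq => // s s0.
have s1 : -1 < s by lra.
have -> : 0 = - k * ou k g (Num.max s 0) +
    k *: (expR (- k * s) *: (expR (k * s) * g s) + F s *: (- k * expR (- k * s))).
  rewrite max_l// /ou FE//.
  have -> : k *: (expR (- k * s) *: (expR (k * s) * g s) +
      F s *: (- k * expR (- k * s))) =
    k * (expR (- k * s) * (expR (k * s) * g s) +
      F s * (- k * expR (- k * s))) by [].
  have -> : expR (- k * s) * (expR (k * s) * g s) = g s.
    by rewrite mulrA -expRD mulNr addNr expR0 mul1r.
  by ring.
have dM := is_deriveM (is_derive_expRM (- k) s) (dF s s1).
exact: is_deriveD (dH s s1) (is_deriveZ k dM).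
Qed.

(** The forcing g cancels in the difference z = x - y, which is differentiable even where x and y
    are not, and satisfies z' = -k z, z(0) = 0. Hence exp(k t) z(t) is constant; the integrating
    factor replaces a Gronwall estimate. *)
Lemma linear_integral_equation_unique (R : realType) (k : R) (x y g : R -> R) :
  continuous (fun t : R => x (Num.max t 0)) ->
  continuous (fun t : R => y (Num.max t 0)) ->
  (forall t : R, 0 <= t ->
    x t = g t + \int[lebesgue_measure]_(s in `[0, t]) (- k * x s)) ->
  (forall t : R, 0 <= t ->
    y t = g t + \int[lebesgue_measure]_(s in `[0, t]) (- k * y s)) ->
  forall t : R, 0 <= t -> x t = y t.
Proof.
move=> cx cy xE yE.
have [F [dF F0 FE]] := antiderivative (@continuous_scale R (- k) _ cx).
have [H [dH H0 HE]] := antiderivative (@continuous_scale R (- k) _ cy).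
have max0E (z : R -> R) (t : R) :
    \int[lebesgue_measure]_(s in `[0, t]) (- k * z s) =
    \int[lebesgue_measure]_(s in `[0, t]) (- k * z (Num.max s 0)).
  apply: eq_Rintegral => s; rewrite inE /= in_itv /= => /andP[s0 _].
  by rewrite max_l.
have {}xE (t : R) : 0 <= t -> x t = g t + F t.
  by move=> t0; rewrite xE// max0E FE.
have {}yE (t : R) : 0 <= t -> y t = g t + H t.
  by move=> t0; rewrite yE// max0E HE.
move=> t t0; rewrite xE// yE//; congr (_ + _).
pose Q (s : R) := expR (k * s) * (F s - H s).
suff : Q t = Q 0.
  rewrite /Q F0 H0 subrr mulr0 => /eqP; rewrite mulf_eq0 gt_eqF ?expR_gt0//=.
  by rewrite subr_eq0 => /eqP.
apply: derive0_eq => // s s0.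
have s1 : -1 < s by lra.
have -> : 0 = expR (k * s) *: (- k * x (Num.max s 0) - - k * y (Num.max s 0)) +
    (F s - H s) *: (k * expR (k * s)).
  have -> : expR (k * s) *: (- k * x (Num.max s 0) - - k * y (Num.max s 0)) +
      (F s - H s) *: (k * expR (k * s)) =
    expR (k * s) * (- k * x (Num.max s 0) - - k * y (Num.max s 0)) +
      (F s - H s) * (k * expR (k * s)) by [].
  by rewrite max_l// xE// yE//; ring.
exact: is_deriveM (is_derive_expRM k s) (is_deriveB (dF s s1) (dH s s1)).
Qed.

(* The majorant exp(k s) (g T + e + M / k + M (T - s)) has derivative
   k exp(k s) (g T + e + M (T - s)), which dominates that of k F. *)
Lemma exp_integral_le (R : realType) (k T e M : R) (F g : R -> R) :
  0 < k -> 0 <= T -> 0 <= e -> 0 <= M ->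
  (forall s : R, 0 <= s -> is_derive s 1 F (expR (k * s) * g s)) -> F 0 = 0 ->
  (forall s : R, 0 <= s <= T -> g s <= g T + e + M * (T - s)) ->
  k * expR (- k * T) * F T <= g T + e + M / k - g T * expR (- k * T).
Proof.
move=> k0 T0 e0 M0 dF F0 gle.
pose Q (s : R) := expR (k * s) * (g T + e + M / k + M * (T - s)) - k * F s.
have dQ (s : R) : 0 <= s -> is_derive s 1 Q
    (k * expR (k * s) * (g T + e + M * (T - s) - g s)).
  move=> s0.
  have dL : is_derive s 1 (fun s : R => g T + e + M / k + M * (T - s)) (- M).
    have -> : - M = 0 + M *: (0 - 1) by rewrite sub0r scalerN add0r [M *: 1]mulr1.
    exact: (@is_deriveD _ _ _ (cst _) (fun s : R => M * (T - s))).
  have -> : k * expR (k * s) * (g T + e + M * (T - s) - g s) =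
     expR (k * s) *: - M +
     (g T + e + M / k + M * (T - s)) *: (k * expR (k * s)) -
     k *: (expR (k * s) * g s).
    have -> : expR (k * s) *: - M +
     (g T + e + M / k + M * (T - s)) *: (k * expR (k * s)) -
     k *: (expR (k * s) * g s) =
     expR (k * s) * - M +
     (g T + e + M / k + M * (T - s)) * (k * expR (k * s)) -
     k * (expR (k * s) * g s) by [].
    by field; rewrite gt_eqF.
  exact: is_deriveB (is_deriveM (is_derive_expRM k s) dL) (is_deriveZ k (dF s s0)).
have : Q 0 <= Q T.
  apply: (@ger0_derive1_le_cc R Q 0 T).
  - by move=> s /[!in_itv]/= /andP[/ltW/dQ[]].
  - move=> s /[!in_itv]/= /andP[s0 sT].
    have ? := dQ s (ltW s0); rewrite derive1E derive_val.
    by rewrite mulr_ge0 ?mulr_ge0 ?expR_ge0 ?(ltW k0)// subr_ge0 gle// !ltW.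
  - exact: within_continuous_derive.
  - by rewrite in_itv/= lexx.
  - by rewrite in_itv/= T0 lexx.
  - exact: T0.
rewrite /Q F0 mulr0 expR0 !subr0 mul1r subrr mulr0 addr0 => Q0T.
have E1 : expR (- k * T) * expR (k * T) = 1.
  by rewrite -expRD mulNr addNr expR0.
have : expR (- k * T) * (g T + e + M / k + M * T) <=
    expR (- k * T) * (expR (k * T) * (g T + e + M / k) - k * F T).
  by rewrite ler_wpM2l ?expR_ge0.
rewrite mulrBr mulrA E1 mul1r => H.
(* The part e + M / k + M T of Q(0) is nonnegative and is dropped; g T has no known sign and stays
   in the bound. *)
have : 0 <= expR (- k * T) * (e + M / k + M * T).
  by rewrite mulr_ge0 ?expR_ge0// !addr_ge0 ?mulr_ge0 ?invr_ge0 ?(ltW k0).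
lra.
Qed.

(** The kernel k exp(-k (T - s)) has mass 1 - exp(-k T) on [0, T], and the missing mass leaves the
    term in |g T|; its first moment in T - s is at most 1 / k, whence M / k. The two signs come from
    the one-sided bound applied to g and to -g. *)
Lemma ou_norm_le (R : realType) (k T e M : R) (g : R -> R) :
  0 < k -> 0 <= T -> 0 <= e -> 0 <= M -> continuous g ->
  (forall s : R, 0 <= s <= T -> `|g s - g T| <= e + M * (T - s)) ->
  `|ou k g T| <= e + M / k + `|g T| * expR (- k * T).
Proof.
move=> k0 T0 e0 M0 cg gle.
have [F [dF F0 FE]] := antiderivative (@ou_integrand_continuous R k g cg).
have {}dF (s : R) : 0 <= s -> is_derive s 1 F (expR (k * s) * g s).
  by move=> s0; apply: dF; lra.
rewrite /ou FE//.
have H1 : k * expR (- k * T) * F T <= g T + e + M / k - g T * expR (- k * T).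
  apply: exp_integral_le => // s /gle; rewrite ler_norml; lra.
have H2 : k * expR (- k * T) * - F T <=
    - g T + e + M / k - - g T * expR (- k * T).
  apply: (@exp_integral_le R k T e M (fun s : R => - F s) (fun s : R => - g s)) => //.
  - move=> s s0; rewrite mulrN; exact: is_deriveN (dF s s0).
  - by rewrite F0 oppr0.
  - move=> s /gle; rewrite ler_norml; lra.
have : `|g T * expR (- k * T)| <= `|g T| * expR (- k * T).
  by rewrite normrM (ger0_norm (expR_ge0 _)).
by rewrite !ler_norml => /andP[H3 H4]; apply/andP; split; lra.
Qed.

Lemma ou_cvg0 (R : realType) (T : R) (g : R -> R) : 0 < T -> continuous g ->
  ou k g T @[k --> +oo] --> 0.
Proof.
move=> T0 cg; apply/cvgr0Pnorm_le => e e0.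
have e20 : 0 < e / 2 by rewrite divr_gt0.
have /cvgrPdist_le /(_ _ e20) /nbhs_ballP[r /= r0 rP] := cg T.
have [c _ cmax] := @EVT_max R (fun s : R => `|g s - g T|) 0 T (ltW T0)
  ltac:(apply: continuous_subspaceT => s; apply: cvg_norm; apply: cvgB;
    [exact: cg|exact: cvg_cst]).
(* Close to T use continuity, elsewhere the linear term absorbs the bound. *)
pose M := `|g c - g T| / r.
have M0 : 0 <= M by rewrite divr_ge0 ?(ltW r0).
have gle (s : R) : 0 <= s <= T -> `|g s - g T| <= e / 2 + M * (T - s).
  move=> /andP[s0 sT]; have [Tsr|rTs] := ltP (T - s) r.
    rewrite distrC (le_trans (rP s _))//; last first.
      by rewrite lerDl mulr_ge0// subr_ge0.
    by rewrite /ball /= ger0_norm ?subr_ge0.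
  rewrite (le_trans (cmax s _)) ?in_itv/= ?s0//.
  have -> : `|g c - g T| = M * r by rewrite divfK// gt_eqF.
  by rewrite (le_trans (ler_wpM2l M0 rTs))// lerDr ltW.
near=> k.
have k0 : 0 < k by near: k; exact: nbhs_pinfty_gt.
apply: le_trans (ou_norm_le k0 (ltW T0) (ltW e20) M0 cg gle) _.
(* By exp(x) >= 1 + x; both remaining terms are then bounded by constants over k. *)
have eT : expR (- k * T) <= (k * T)^-1.
  rewrite mulNr expRN lef_pV2 ?posrE ?expR_gt0 ?mulr_gt0//.
  by rewrite (le_trans _ (expR_ge1Dx _))// lerDr.
have : `|g T| * expR (- k * T) <= `|g T| * (k * T)^-1 by rewrite ler_wpM2l.
suff : M / k + `|g T| * (k * T)^-1 <= e / 2 by lra.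
have -> : M / k + `|g T| * (k * T)^-1 = (M + `|g T| / T) / k.
  by field; rewrite !gt_eqF.
rewrite ler_pdivrMr// -ler_pdivrMl; last by [].
near: k; apply: nbhs_pinfty_ge; exact: num_real.
Unshelve. all: by end_near. Qed.

(** * Riemann sums and measurability *)

(** Heine-Cantor by compactness, with the radius halved at each point. Only x is confined to the
    segment; y may leave it, since f is continuous on the whole line. *)
Lemma segment_uniformly_continuous (R : realType) (f : R -> R) (a b e : R) :
  continuous f -> 0 < e ->
  exists2 r : R, 0 < r & forall x y : R, a <= x <= b -> `|x - y| < r ->
    `|f x - f y| < e.
Proof.
move=> cf e0.
have /compact_near_coveringP cov := @segment_compact R a b.
have /cov : forall x, `[a, b]%classic x -> \forall x' \near x & r \near 0^'+,
    (fun (r x : R) => forall y : R, `|x - y| < r -> `|f x - f y| < e) r x'.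
  move=> x _.
  have /cvgrPdist_lt /(_ (e / 2)) := cf x.
  rewrite divr_gt0// => /(_ isT) /nbhs_ballP[d /= d0 dP].
  exists (ball x (d / 2), [set r | r < d / 2]).
    split; first by apply: nbhsx_ballx; rewrite divr_gt0.
    by apply: nbhs_right_lt; rewrite divr_gt0.
  move=> [x' r] /= [xx' rd] y x'y.
  have H1 := dP x'; have H2 := dP y.
  rewrite -[f x'](subrK (f x)) -addrA (le_lt_trans (ler_normD _ _))//.
  rewrite [e]splitr ltrD//.
    by rewrite distrC H1// /ball/= (lt_trans xx')// ltr_pdivrMr// ltr_pMr// ltr1n.
  apply: H2; rewrite /ball/= -[x](subrK x') -addrA (le_lt_trans (ler_normD _ _))//.
  by rewrite [d]splitr ltrD// (lt_trans x'y).
move=> H; near (0 : R)^'+ => r.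
exists r; first by near: r; exact: nbhs_right_gt.
move=> x y xab; have : `[a, b]%classic `<=` (fun x : R => forall y : R,
  `|x - y| < r -> `|f x - f y| < e) by near: r.
by move=> /(_ x xab y).
Unshelve. all: by end_near. Qed.

(* The mean value theorem writes each increment of a primitive as a value of f. *)
Lemma riemann_sum_cvg (R : realType) (f : R -> R) (t : R) :
  continuous f -> 0 <= t ->
  \sum_(0 <= i < N.+1) f (t / N.+1%:R * i%:R) * (t / N.+1%:R)
    @[N --> \oo] --> \int[lebesgue_measure]_(s in `[0, t]) f s.
Proof.
move=> cf t0.
have [F [dF F0 FE]] := antiderivative cf.
rewrite FE//; apply/cvgrPdist_le => e e0.
(* Dividing by t + 1 rather than t covers t = 0; the total error is then at most e t / (t + 1) <=
   e. *)
have e't : 0 < e / (t + 1) by rewrite divr_gt0// ltr_wpDl.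
have [r r0 rP] := @segment_uniformly_continuous R f 0 t _ cf e't.
near=> N.
pose d := t / N.+1%:R.
have d0 : 0 <= d by rewrite divr_ge0.
have dN : d * N.+1%:R = t by rewrite divfK.
have dr : d < r.
  rewrite ltr_pdivrMr// -ltr_pdivrMl; last by [].
  rewrite (@lt_trans _ _ N%:R) ?ltr_nat//.
  by near: N; exact: nbhs_infty_gtr.
have -> : F t = \sum_(0 <= i < N.+1) (F (d * i.+1%:R) - F (d * i%:R)).
  by rewrite (telescope_sumr (fun i => F (d * i%:R)))// mulr0 F0 subr0 dN.
rewrite -sumrB (le_trans (ler_norm_sum _ _ _))//.
have : \sum_(0 <= i < N.+1) (e / (t + 1) * d) <= e.
  rewrite sumr_const_nat subn0 -mulr_natr -mulrA dN -mulrA ger_pMr//.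
  by rewrite mulrC ler_pdivrMr ?mul1r ?ltr_wpDl// lerDl.
apply: le_trans; rewrite !big_nat; apply: ler_sum => i /= iN.
have id0 : 0 <= d * i%:R by rewrite mulr_ge0.
have idi : d * i%:R <= d * i.+1%:R by rewrite ler_wpM2l// ler_nat.
have [||c] := @MVT_segment R F f (d * i%:R) (d * i.+1%:R) idi.
- move=> s; rewrite in_itv/= => /andP[s0 _]; apply: dF; lra.
- apply: within_continuous_derive => s s0; apply: dF; lra.
rewrite in_itv/= => /andP[ic ci] ->.
rewrite -mulrBr -natrB// subSnn mulr1 -mulrBl normrM (ger0_norm d0).
rewrite ler_wpM2r// ltW// rP//.
  rewrite (le_trans id0 ic)/= (le_trans ci)// -dN ler_wpM2l// ler_nat//.
rewrite ger0_norm ?subr_ge0// (le_lt_trans _ dr)// lerBlDr (le_trans ci)//.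
by rewrite mulrSr mulrDr mulr1 addrC.
Unshelve. all: by end_near. Qed.

Lemma continuous_sum (T : topologicalType) (R : realType) (I : Type)
    (r : seq I) (f : I -> T -> R) :
  (forall i, continuous (f i)) -> continuous (fun t => \sum_(i <- r) f i t).
Proof.
move=> cf; elim: r => [|i r IHr].
  rewrite (_ : (fun t => _) = cst 0); first exact: cst_continuous.
  by apply/funext => t; rewrite big_nil.
rewrite (_ : (fun t => _) = fun t => f i t + \sum_(j <- r) f j t).
  by move=> t; apply: cvgD; [exact: cf|exact: IHr].
by apply/funext => t; rewrite big_cons.
Qed.

Lemma continuous_cV (T : topologicalType) (R : realType) (n : nat)
    (f : T -> 'cV[R]_n) :
  (forall i, continuous (fun t => f t i ord0)) -> continuous f.
Proof.
move=> cf t U [Q tQ QU].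
have : \forall t' \near t, forall i j, Q i j (f t' i j).
  apply: filter_forall => i; apply: filter_forall => j.
  by have := tQ i j; rewrite (ord1 j) => /cf.
by apply: filterS => t' ?; apply: QU.
Qed.

(** Boxes with rational centre and half-width 1 / (j + 1) form a countable base, and U is the union
    of those it contains. [None] marks the indices that code no such box and contributes the empty
    set. *)
Lemma open_cV_bigcup (R : realType) (n : nat) (U : set 'cV[R]_n) : open U ->
  exists c : nat -> option ('cV[rat]_n * nat),
  U = \bigcup_k [set x | if c k is Some q then
    forall i, `|x i ord0 - ratr (q.1 i ord0)| < q.2.+1%:R^-1 else False].
Proof.
move=> oU.
pose box (q : 'cV[rat]_n * nat) : set 'cV[R]_n :=
  [set x | forall i, `|x i ord0 - ratr (q.1 i ord0)| < q.2.+1%:R^-1].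
exists (fun k => if unpickle k is Some q then
  if `[< box q `<=` U >] then Some q else None else None).
apply/seteqP; split=> [x Ux|x [k _] /=]; last first.
  by case: unpickle => // q; case: asboolP => // qU /qU.
have /nbhs_ballP[e /= e0 eU] : nbhs x U by exact: open_nbhs_nbhs.
(* Two points of a box of half-width 1 / (k + 1) are less than 2 / (k + 1) < e apart in the sup
   norm, so a box around x stays in the ball. *)
have [k ke] : exists k : nat, 2 / e < k.+1%:R.
  have [k _ /(_ k (leqnn k)) ke] := nbhs_infty_gtr (2 / e).
  by exists k; rewrite (lt_trans ke)// ltr_nat.
have k0 : 0 < k.+1%:R^-1 :> R by rewrite invr_gt0.
have qx i : exists q : rat, `|x i ord0 - ratr q| < k.+1%:R^-1.
  have /rat_in_itvoo[q] : x i ord0 - k.+1%:R^-1 < x i ord0 + k.+1%:R^-1.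
    by rewrite ltrD2l gtrN.
  by rewrite in_itv/= => qx; exists q; rewrite distrC ltr_distl.
pose q := (\col_i xchoose (qx i), k).
have qP i : `|x i ord0 - ratr (q.1 i ord0)| < q.2.+1%:R^-1.
  by rewrite mxE; exact: xchooseP (qx i).
exists (pickle q) => //=; rewrite pickleK asboolT//.
move=> y yq; apply: eU; split => // i j; rewrite (ord1 j) /ball/=.
rewrite -[x i ord0](subrK (ratr (q.1 i ord0))) -addrA.
rewrite (le_lt_trans (ler_normD _ _))//.
have := yq i; have := qP i; rewrite distrC /= => H1 H2.
rewrite -[_ - y _ _]opprB normrN; move: H1; rewrite distrC => H1.
rewrite (lt_trans (ltrD H1 H2))//.
have -> : k.+1%:R^-1 + k.+1%:R^-1 = 2 / k.+1%:R :> R by ring.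
by rewrite ltr_pdivrMr// mulrC -ltr_pdivrMr.
Qed.

(** Sets with measurable preimage form a sigma-algebra, so open sets suffice; these are countable
    unions of boxes, whose preimages are finite intersections over the coordinates. *)
Lemma borel_preimage_measurable (d : measure_display) (T : measurableType d)
    (R : realType) (n : nat) (X : T -> 'cV[R]_n) :
  (forall i, measurable_fun setT (fun w => X w i ord0)) ->
  forall S, borel 'cV[R]_n S -> measurable (X @^-1` S).
Proof.
move=> mX S bS.
suff : image_set_system setT X measurable S by rewrite /image_set_system/= setTI.
apply: (smallest_sub _ _ bS) => [|U oU].
  exact/sigma_algebra_image/sigma_algebra_measurable.
rewrite /image_set_system/= setTI.
have [c ->] := open_cV_bigcup oU.
rewrite preimage_bigcup; apply: bigcupT_measurable => k.
case: (c k) => [q|]; last first.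
  by rewrite (_ : _ @^-1` _ = set0)//; apply/seteqP; split.
rewrite [X in measurable X](_ : _ = \big[setI/setT]_(i < n)
   ((fun w => X w i ord0) @^-1`
     [set y | `|y - ratr (q.1 i ord0)| < q.2.+1%:R^-1])); last first.
  rewrite -bigcap_seq; apply/seteqP; split=> [w /= H i _|w H i]; first exact: H.
  by apply: H; rewrite /= mem_index_enum.
apply: bigsetI_measurable => i _.
rewrite -[X in measurable X]setTI; apply: mX => //.
rewrite (_ : [set y | _] =
  `]ratr (q.1 i ord0) - q.2.+1%:R^-1, ratr (q.1 i ord0) + q.2.+1%:R^-1[%classic).
  exact: measurable_itv.
by apply/seteqP; split=> y; rewrite /= in_itv/= ltr_distl.
Qed.

Lemma measurable_fun_borel (d : measure_display) (T : measurableType d)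
    (E : topologicalType) (R : realType) (X : T -> E) (f : E -> R) :
  (forall S, borel E S -> measurable (X @^-1` S)) -> continuous f ->
  measurable_fun setT (fun w => f (X w)).
Proof.
move=> mX cf; apply: (measurability _ (RGenOpens.measurableE R)).
move=> _ [_ [x [y ->]] <-]; rewrite setTI.
apply: (mX (f @^-1` `]x, y[)); apply: sub_sigma_algebra.
by move: cf => /continuousP; apply; exact: itv_open.
Qed.

(* By compactness a zero exists iff |Y| gets arbitrarily small at rational times,
   clipped to [0, b] so that b itself is reached when it is irrational. *)
Lemma measurable_ex_zero (d : measure_display) (T : measurableType d)
    (R : realType) (Y : R -> T -> R) (b : R) : 0 <= b ->
  (forall w, continuous (Y ^~ w)) ->
  (forall t : R, 0 <= t -> measurable_fun setT (Y t)) ->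
  measurable [set w | exists2 t : R, 0 <= t <= b & Y t w = 0].
Proof.
move=> b0 cY mY.
pose clip (q : R) := Num.max (Num.min q b) 0.
have clip_itv (q : R) : 0 <= clip q <= b.
  by rewrite /clip le_max lexx orbT /= ge_max b0 ge_min lexx orbT.
have clipK (t : R) : 0 <= t <= b -> clip t = t.
  by move=> /andP[t0 tb]; rewrite /clip min_l// max_l.
have clip_cont : continuous clip.
  move=> t; apply: (@continuous_max R R (fun q : R => Num.min q b) (cst 0)).
    apply: (@continuous_min R R id (cst b)) => //; exact: cst_continuous.
  exact: cst_continuous.
rewrite (_ : [set w | _] = \bigcap_(m : nat) \bigcup_(q : rat)
    ((fun w => `|Y (clip (ratr q)) w|) @^-1` `]-oo, m.+1%:R^-1[)).
  apply: bigcapT_measurable => m; apply: bigcupT_measurable_rat => q.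
  rewrite -[X in measurable X]setTI.
  have /andP[q0 _] := clip_itv (ratr q).
  by apply: (measurableT_comp (@normr_measurable R setT) (mY _ q0)).
apply/seteqP; split=> [w [t tb Yt0] m _|w H] /=.
  have : continuous (fun q => `|Y (clip q) w|).
    move=> q; apply: cvg_norm.
    exact: (@continuous_comp _ _ _ clip (Y ^~ w) q (clip_cont q) (cY w _)).
  move=> /continuousP/(_ _ (@lray_open _ R m.+1%:R^-1)) oV.
  have [|y [Vy [q _ qy]]] := @dense_rat R _ _ oV.
    by exists t; rewrite /= in_itv/= clipK// Yt0 normr0 invr_gt0.
  by exists q => //; rewrite /= qy.
have cYw : {within `[0, b], continuous (fun t : R => `|Y t w|)}.
  by apply: continuous_subspaceT => t; apply: cvg_norm; exact: cY.
have [c cb cmin] := EVT_min b0 cYw.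
exists c; first by rewrite in_itv/= in cb.
apply/eqP; rewrite -normr_eq0; apply/negP => /negP Yc0.
have {}Yc0 : 0 < `|Y c w| by rewrite lt_neqAle eq_sym Yc0/=.
have [m mY'] : exists m : nat, m.+1%:R^-1 < `|Y c w|.
  have [k _ /(_ k (leqnn k)) ke] := nbhs_infty_gtr `|Y c w|^-1.
  exists k; rewrite invf_plt ?posrE//.
  by rewrite (lt_trans ke)// ltr_nat.
have [q _] := H m I; rewrite /= in_itv/= => Hq.
have := cmin (clip (ratr q)); rewrite in_itv/= => /(_ (clip_itv _)).
by rewrite leNgt (lt_trans Hq mY').
Qed.

(** * The Euclidean norm and the sphere *)

Lemma enorm_continuous (R : realType) (n : nat) : continuous (@enorm R n).
Proof.
move=> x; apply: (@continuous_comp _ _ _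
  (fun x : 'cV[R]_n => \sum_i x i ord0 ^+ 2) Num.sqrt).
  apply: continuous_sum => i y.
  apply: (@continuous_comp _ _ _ (fun x : 'cV[R]_n => x i ord0) (fun y : R => y ^+ 2)).
    exact: coord_continuous.
  exact: exprn_continuous.
exact: sqrt_continuous.
Qed.

(** Continuity of the norm makes the ball open and keeps its closure in the closed ball; conversely
    a point x of norm r is the limit of the interior points (1 - s) x as s decreases to 0. *)
Lemma boundary_eball0 (R : realType) (n : nat) (r : R) (x : 'cV[R]_n) :
  0 < r -> boundary (eball0 n r) x <-> enorm x = r.
Proof.
move=> r0.
have oB : open (eball0 n r).
  rewrite (_ : eball0 n r = @enorm R n @^-1` `]-oo, r[); last first.
    by apply/seteqP; split=> y; rewrite /eball0 /= in_itv.
  by have /continuousP := @enorm_continuous R n; apply; exact: lray_open.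
have cB : closed [set y : 'cV[R]_n | enorm y <= r].
  rewrite (_ : [set _ | _] = @enorm R n @^-1` `]-oo, r]); last first.
    by apply/seteqP; split=> y; rewrite /= in_itv.
  by have /continuous_closedP := @enorm_continuous R n; apply; exact: lray_closed.
rewrite /boundary; split.
  move=> [clx]; rewrite ((interior_id _).1 oB) => /negP; rewrite -leNgt => rx.
  apply/eqP; rewrite eq_le rx andbT.
  have sub : eball0 n r `<=` [set y : 'cV[R]_n | enorm y <= r] by move=> y /ltW.
  by move: clx => /(closure_subset sub); rewrite -((closure_id _).1 cB).
move=> xr; split; last by rewrite ((interior_id _).1 oB) /eball0/= xr ltxx.
have H : (1 - s) *: x @[s --> (0 : R)^'+] --> x.
  apply: cvg_at_right_filter.
  rewrite -[X in _ --> X]scale1r -[X in X *: _]subr0.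
  by apply: cvgZr_tmp; apply: cvgB; [exact: cvg_cst|exact: cvg_id].
move=> V /H xV; near (0 : R)^'+ => s.
have s0 : 0 < s by near: s; exact: nbhs_right_gt.
have s1 : s < 1 by near: s; exact: nbhs_right_lt.
exists ((1 - s) *: x); split; last by near: s.
rewrite /eball0/= /enorm.
under eq_bigr do rewrite mxE exprMn.
rewrite -mulr_sumr sqrtrM ?sqr_ge0// sqrtr_sqr ger0_norm ?subr_ge0 ?ltW//.
rewrite -[X in _ * X]/(enorm x) xr; nra.
Unshelve. all: by end_near. Qed.

(** * The feedback law and the explicit process *)

(* W - W_0 along continuous paths, extended by 0 to negative times and replaced
   by 0 on the other paths: these form a null set, which belongs to every F t by
   the usual conditions, so adaptedness is kept while all paths are continuous. *)
Definition centered (R : realType) (Omega : Type) (m : nat)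
    (W : R -> Omega -> 'cV[R]_m) (t : R) (w : Omega) : 'cV[R]_m :=
  if `[< {within `[0, +oo[, continuous (W ^~ w)} >]
  then W (Num.max t 0) w - W 0 w else 0.

Definition forcing (R : realType) (Omega : Type) (n m : nat)
    (W : R -> Omega -> 'cV[R]_m) (C : 'M[R]_(n, m)) (x0 : 'cV[R]_n)
    (i : 'I_n) (w : Omega) (t : R) : R :=
  x0 i ord0 + \sum_j C i j * centered W t w j ord0.

Definition ou_process (R : realType) (Omega : Type) (n m : nat)
    (W : R -> Omega -> 'cV[R]_m) (C : 'M[R]_(n, m)) (k : R) (x0 : 'cV[R]_n)
    (t : R) (w : Omega) : 'cV[R]_n :=
  \col_i ou k (forcing W C x0 i w) t.

Definition feedback (R : realType) (n : nat) (A B : 'M[R]_n) (k : R)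
    (t : R) (x : 'cV[R]_n) : 'cV[R]_n :=
  invmx B *m (- k *: x - A *m x).

Lemma drift_feedback (R : realType) (n : nat) (A B : 'M[R]_n) (k : R) :
  \rank B = n -> drift A B (feedback A B k) = fun t x => - k *: x.
Proof.
move=> rB; apply/funext => t; apply/funext => x.
have uB : B \in unitmx by rewrite -row_free_unit /row_free rB.
by rewrite /drift /feedback mulKVmx// addrC subrK.
Qed.

Lemma mulmx_continuous (R : realType) (n : nat) (M : 'M[R]_n) :
  continuous (fun x : 'cV[R]_n => M *m x).
Proof.
apply: continuous_cV => i.
rewrite (_ : (fun x => _) = fun x : 'cV[R]_n => \sum_j M i j * x j ord0).
  apply: continuous_sum => j x.
  apply: (@continuous_comp _ _ _ (fun x : 'cV[R]_n => x j ord0)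
    (fun y : R => M i j * y)); first exact: coord_continuous.
  by apply: (@continuous_scale R (M i j) id) => y; exact: cvg_id.
by apply/funext => x; rewrite mxE.
Qed.

(** The law is a continuous function of x alone, so the set is a closed half-space intersected with
    the preimage of S under a continuous map. *)
Lemma feedback_borel (R : realType) (n : nat) (A B : 'M[R]_n) (k : R)
    (S : set 'cV[R]_n) : borel 'cV[R]_n S ->
  borel (R * 'cV[R]_n)%type
    [set tx | 0 <= tx.1 /\ S (feedback A B k tx.1 tx.2)].
Proof.
move=> bS; pose f (tx : R * 'cV[R]_n) := invmx B *m ((- k)%:M - A) *m tx.2.
have cf : continuous f.
  move=> tx; apply: (@continuous_comp _ _ _ snd (mulmx (invmx B *m ((- k)%:M - A)))).
    exact: cvg_snd.
  exact: mulmx_continuous.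
rewrite (_ : [set tx | _] = [set tx | 0 <= tx.1] `&` f @^-1` S); last first.
  by apply/seteqP; split=> tx /=; rewrite /f /feedback -mulmxA mulmxBl mul_scalar_mx.
pose bT : Type := g_sigma_algebraType (@open (R * 'cV[R]_n)%type).
change (@measurable _ bT ([set tx | 0 <= tx.1] `&` f @^-1` S)).
apply: measurableI.
  rewrite -[X in measurable X]setCK; apply: measurableC.
  apply: sub_sigma_algebra; rewrite openC.
  rewrite (_ : [set tx | _] = fst @^-1` `[0, +oo[); last first.
    by apply/seteqP; split=> tx /=; rewrite in_itv/= andbT.
  have /continuous_closedP : continuous (@fst R 'cV[R]_n) by move=> x; exact: cvg_fst.
  by apply; exact: rray_closed.
have : image_set_system setT f (@measurable _ bT) S.
  apply: (smallest_sub _ _ bS) => [|U oU].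
    exact/sigma_algebra_image/sigma_algebra_measurable.
  rewrite /image_set_system/= setTI; apply: sub_sigma_algebra.
  by move: cf => /continuousP; apply.
by rewrite /image_set_system/= setTI.
Qed.

Lemma forcing_continuous (R : realType) (Omega : Type) (n m : nat)
    (W : R -> Omega -> 'cV[R]_m) (C : 'M[R]_(n, m)) (x0 : 'cV[R]_n)
    (i : 'I_n) (w : Omega) : continuous (forcing W C x0 i w).
Proof.
move=> t; apply: cvgD; first exact: cvg_cst.
apply: (@continuous_sum R R _ (index_enum _)
  (fun j t => C i j * centered W t w j ord0)) => j.
apply: continuous_scale => {}t.
rewrite /centered; case: asboolP => [cW|_]; last exact: cvg_cst.
apply: (@continuous_comp _ _ _ (fun t : R => W (Num.max t 0) w - W 0 w)
  (fun x : 'cV[R]_m => x j ord0)); last exact: coord_continuous.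
by apply: cvgB; [exact: ((continuous_max0 (W ^~ w)).1 cW)|exact: cvg_cst].
Qed.

Lemma ou_process_continuous (R : realType) (Omega : Type) (n m : nat)
    (W : R -> Omega -> 'cV[R]_m) (C : 'M[R]_(n, m)) (k : R) (x0 : 'cV[R]_n)
    (w : Omega) : continuous (fun t : R => ou_process W C k x0 (Num.max t 0) w).
Proof.
apply: continuous_cV => i.
rewrite (_ : (fun t => _) = fun t => ou k (forcing W C x0 i w) (Num.max t 0)).
  by apply: ou_max0_continuous; exact: forcing_continuous.
by apply/funext => t; rewrite mxE.
Qed.

Lemma ou_process0 (R : realType) (Omega : Type) (n m : nat)
    (W : R -> Omega -> 'cV[R]_m) (C : 'M[R]_(n, m)) (k : R) (x0 : 'cV[R]_n)
    (w : Omega) : ou_process W C k x0 0 w = x0.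
Proof.
apply/colP => i; rewrite mxE /ou set_itv1 Rintegral_set1 mulr0 subr0 /forcing.
rewrite big1 ?addr0// => j _; rewrite /centered maxxx subrr.
by case: ifP; rewrite mxE mulr0.
Qed.

(** Holds for every w without exception, since [centered] makes all forcing paths continuous. *)
Lemma ou_process_cvg0 (R : realType) (Omega : Type) (n m : nat)
    (W : R -> Omega -> 'cV[R]_m) (C : 'M[R]_(n, m)) (x0 : 'cV[R]_n)
    (t : R) (w : Omega) : 0 < t ->
  enorm (ou_process W C k x0 t w) @[k --> +oo] --> (0 : R).
Proof.
move=> t0; have <- : enorm (0 : 'cV[R]_n) = 0.
  by rewrite /enorm big1 ?sqrtr0// => i _; rewrite mxE expr0n.
apply: (@cvg_comp _ _ _ (fun k => ou_process W C k x0 t w)); last first.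
  exact: enorm_continuous.
move=> U [Q Q0 QU].
have : \forall k \near +oo, forall i j, Q i j (ou_process W C k x0 t w i j).
  apply: filter_forall => i; apply: filter_forall => j.
  have := Q0 i j; rewrite (ord1 j) mxE.
  move=> /(ou_cvg0 t0 (@forcing_continuous R Omega n m W C x0 i w)).
  by apply: (@filterS _ +oo) => k /=; rewrite mxE.
by apply: (@filterS _ +oo) => k ?; apply: QU.
Qed.

(** * Adaptedness, existence and uniqueness *)

(** By completeness both differences of A and B are measurable null sets, and B arises from A by
    removing one and adding the other. This carries the hitting event from the explicit process to
    an arbitrary solution. *)
Lemma ae_measurable (d : measure_display) (T : measurableType d)
    (R : realType) (P : probability T R) (A B : set T) :
  measure_is_complete P -> measurable A -> {ae P, forall w, A w <-> B w} ->
  measurable B /\ P B = P A.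
Proof.
move=> cP mA AB.
have nAB : P.-negligible (A `\` B) by
  apply: negligibleS AB => w [Aw nBw] /= H; exact/nBw/H.
have nBA : P.-negligible (B `\` A) by
  apply: negligibleS AB => w [Bw nAw] /= H; exact/nAw/H.
have mAB := cP _ nAB; have mBA := cP _ nBA.
have BE : B = (A `\` (A `\` B)) `|` (B `\` A).
  by rewrite setDD setIC setUIDK.
have AE : A = (A `\` (A `\` B)) `|` (A `\` B).
  by rewrite setDD setUIDK.
have mB : measurable B by rewrite BE; apply: measurableU => //; exact: measurableD.
split=> //; rewrite BE [in RHS]AE.
rewrite !measureU//; try exact: measurableD.
- by rewrite !(measure_negligible _ nAB)// (measure_negligible _ nBA)// !adde0.
- by apply/seteqP; split=> w //= [[? ?]].
- by apply/seteqP; split=> w //= [[? ?] [? ?]].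
Qed.

(** The integral is a pointwise limit of Riemann sums with nodes at most t. Since no later time
    enters, the lemma applies to the sigma-algebra [F t] and yields adaptedness. *)
Lemma ou_measurable (d : measure_display) (T : measurableType d)
    (R : realType) (k t : R) (g : T -> R -> R) : 0 <= t ->
  (forall w, continuous (g w)) ->
  (forall s : R, s <= t -> measurable_fun setT (g ^~ s)) ->
  measurable_fun setT (fun w => ou k (g w) t).
Proof.
move=> t0 cg mg; apply: measurable_funB; first exact: mg.
apply: measurable_funM; first exact: measurable_cst.
apply: (@measurable_fun_cvg _ _ _ _ (fun N w => \sum_(0 <= i < N.+1)
  (expR (k * (t / N.+1%:R * i%:R)) * g w (t / N.+1%:R * i%:R)) * (t / N.+1%:R))).
  move=> N; rewrite (_ : (fun w => _) = fun w => \sum_(i < N.+1)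
    (expR (k * (t / N.+1%:R * i%:R)) * g w (t / N.+1%:R * i%:R)) *
      (t / N.+1%:R)); last by apply/funext => w; rewrite big_mkord.
  apply: measurable_sum => i; apply: measurable_funM; last exact: measurable_cst.
  apply: measurable_funM; first exact: measurable_cst.
  apply: mg; rewrite mulrAC ler_pdivrMr// ler_wpM2l// ler_nat.
  by rewrite ltnW.
move=> w _; apply: (riemann_sum_cvg (@ou_integrand_continuous R k _ (cg w)) t0).
Qed.

Lemma centered_measurable (R : realType) (d : measure_display)
    (Omega : measurableType d) (P : probability Omega R)
    (F : R -> set (set Omega)) (m : nat) (W : R -> Omega -> 'cV[R]_m)
    (s t : R) (j : 'I_m) :
  usual_filtration P F -> brownian_motion P F W -> 0 <= t -> s <= t ->
  measurable_fun setT
    (fun w : g_sigma_algebraType (F t) => centered W s w j ord0).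
Proof.
move=> uF bW t0 st.
have mW (r : R) : 0 <= r -> r <= t -> measurable_fun setT
    (fun w : g_sigma_algebraType (F t) => W r w j ord0).
  move=> r0 rt.
  apply: (@measurable_fun_borel _ (g_sigma_algebraType (F t)) _ R (W r)
    (fun x : 'cV[R]_m => x j ord0)).
    move=> S bS; apply: sub_sigma_algebra.
    exact: (usual_nondecreasing uF r0 rt (brownian_adapted bW r0 bS)).
  exact: coord_continuous.
rewrite (_ : (fun w => _) = fun w =>
  if `[< {within `[0, +oo[, continuous (W ^~ w)} >]
  then W (Num.max s 0) w j ord0 - W 0 w j ord0 else 0); last first.
  by apply/funext => w; rewrite /centered; case: ifP => _; rewrite !mxE.
apply: measurable_fun_ifT; last exact: measurable_cst.
  apply: (@measurable_fun_bool _ _ _ _ false); rewrite setTI.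
  apply: sub_sigma_algebra; apply: (usual_nondecreasing uF (lexx 0) t0).
  apply: (usual_null_sets uF); apply: negligibleS (brownian_continuous bW).
  by move=> w /= /negbT /asboolPn.
by apply: measurable_funB; apply: mW; rewrite ?le_max ?lexx ?orbT// ge_max st.
Qed.

Lemma ou_process_adapted (R : realType) (d : measure_display)
    (Omega : measurableType d) (P : probability Omega R)
    (F : R -> set (set Omega)) (n m : nat) (W : R -> Omega -> 'cV[R]_m)
    (C : 'M[R]_(n, m)) (k : R) (x0 : 'cV[R]_n) :
  usual_filtration P F -> brownian_motion P F W ->
  adapted F (ou_process W C k x0).
Proof.
move=> uF bW t t0 S bS.
(* [F t] is a sigma-algebra, hence equals the one it generates; the goal becomes measurability in
   the type carrying it. *)
rewrite -(measurable_g_measurableTypeE (usual_sigma_algebra uF t0)).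
apply: (borel_preimage_measurable _ bS) => i.
rewrite (_ : (fun w => _) = fun w => ou k (forcing W C x0 i w) t); last first.
  by apply/funext => w; rewrite mxE.
apply: ou_measurable => // [w|s st]; first exact: forcing_continuous.
apply: measurable_funD; first exact: measurable_cst.
apply: measurable_sum => j; apply: measurable_funM; first exact: measurable_cst.
exact: centered_measurable uF bW t0 st.
Qed.

Lemma ou_process_solution (R : realType) (d : measure_display)
    (Omega : measurableType d) (P : probability Omega R)
    (F : R -> set (set Omega)) (n m : nat) (W : R -> Omega -> 'cV[R]_m)
    (A B : 'M[R]_n) (C : 'M[R]_(n, m)) (k : R) (x0 : 'cV[R]_n) :
  usual_filtration P F -> brownian_motion P F W -> \rank B = n ->
  closed_loop_solution P F W A B C (feedback A B k) x0 (ou_process W C k x0).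
Proof.
move=> uF bW rB; split; first exact: ou_process_adapted uF bW.
(* The only exceptional paths are the discontinuous ones of W; elsewhere [centered] is W_t - W_0 for
   t >= 0. *)
rewrite drift_feedback//; apply: filterS (brownian_continuous bW) => w cW.
have cX := @ou_process_continuous R Omega n m W C k x0 w.
have cXi (i : 'I_n) : continuous
    (fun t : R => - k * ou k (forcing W C x0 i w) (Num.max t 0)).
  by apply: continuous_scale; apply: ou_max0_continuous; exact: forcing_continuous.
have XE (i : 'I_n) (t : R) :
    (- k *: ou_process W C k x0 t w) i ord0 = - k * ou k (forcing W C x0 i w) t.
  by rewrite !mxE.
split=> [|||t t0].
- exact: ou_process0.
- exact/continuous_max0.
- move=> t i t0.
  apply: continuous_compact_integrable; first exact: segment_compact.
  apply: (@subspace_eq_continuous _ _ _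
    (fun t : R => - k * ou k (forcing W C x0 i w) (Num.max t 0))).
    move=> s; rewrite inE /= in_itv/= => /andP[s0 _].
    by rewrite max_l//; exact/esym/XE.
  exact: continuous_subspaceT.
- apply/colP => i; rewrite mxE ou_eq//; last exact: forcing_continuous.
  rewrite !mxE [in LHS]/forcing addrAC.
  congr (_ + _ + _).
    by apply: eq_bigr => j _; rewrite /centered asboolT// max_l.
  by apply: eq_Rintegral => s _; exact/esym/XE.
Qed.

(** Both solutions have the same forcing x0 + C (W_t - W_0), so off two null sets each coordinate
    falls under uniqueness for a deterministic scalar equation. *)
Lemma closed_loop_unique (R : realType) (d : measure_display)
    (Omega : measurableType d) (P : probability Omega R)
    (F : R -> set (set Omega)) (n m : nat) (W : R -> Omega -> 'cV[R]_m)
    (A B : 'M[R]_n) (C : 'M[R]_(n, m)) (k : R) (x0 : 'cV[R]_n)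
    (X Y : R -> Omega -> 'cV[R]_n) : \rank B = n ->
  closed_loop_solution P F W A B C (feedback A B k) x0 X ->
  closed_loop_solution P F W A B C (feedback A B k) x0 Y ->
  {ae P, forall w, forall t : R, 0 <= t -> X t w = Y t w}.
Proof.
move=> rB [_ aX] [_ aY]; rewrite drift_feedback// in aX aY.
apply: filterS2 aX aY => w [_ cX _ XE] [_ cY _ YE] t t0.
apply/colP => i.
have coord (Z : R -> Omega -> 'cV[R]_n) : {within `[0, +oo[, continuous (Z ^~ w)} ->
    continuous (fun t : R => Z (Num.max t 0) w i ord0).
  move=> /continuous_max0 cZ s.
  apply: (@continuous_comp _ _ _ (fun t : R => Z (Num.max t 0) w)
    (fun x => x i ord0)); [exact: cZ|exact: coord_continuous].
apply: (@linear_integral_equation_unique R k (fun t : R => X t w i ord0)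
  (fun t : R => Y t w i ord0)
  (fun t : R => x0 i ord0 + (C *m (W t w - W 0 w)) i ord0)) => //.
- exact: coord cX.
- exact: coord cY.
- move=> s s0; rewrite [in LHS]XE// !mxE addrAC.
  by congr (_ + _ + _); apply: eq_Rintegral => r _; rewrite mxE.
- move=> s s0; rewrite [in LHS]YE// !mxE addrAC.
  by congr (_ + _ + _); apply: eq_Rintegral => r _; rewrite mxE.
Qed.

(** * Probability of hitting the sphere *)

(** The rank from which w stays in the A N depends on w. The sets E N of points lying in all A M
    with M >= N increase to the whole space, so P (E N) tends to 1 > p, and E N is contained in A
    N. *)
Lemma eventually_probability_ge (d : measure_display) (T : measurableType d)
    (R : realType) (P : probability T R) (A : nat -> set T) (p : R) :
  p < 1 -> (forall N, measurable (A N)) ->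
  (forall w, \forall N \near \oo, A N w) -> exists N, (p%:E <= P (A N))%E.
Proof.
move=> p1 mA evA.
pose E N := \bigcap_(M in [set M | (N <= M)%N]) A M.
have mE N : measurable (E N) by apply: bigcap_measurable => //; exists N => /=.
have UE : \bigcup_N E N = setT.
  by apply/seteqP; split=> // w _; have [N _ NA] := evA w; exists N.
have homoE : {homo E : N M / (N <= M)%N >-> (N <= M)%O}.
  move=> N M NM; apply/subsetPset => w Ew K /= MK.
  by apply: Ew => /=; exact: leq_trans MK.
have PE : P (E N) @[N --> \oo] --> 1%E.
  rewrite -(probability_setT P) -UE.
  exact: (nondecreasing_cvg_mu mE (bigcupT_measurable E mE) homoE).
have /(_ (cvgP _ PE)) : cvgn (P \o E) ->
    (p%:E < limn (P \o E))%E -> \forall N \near \oo, (p%:E <= (P \o E) N)%E.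
  apply: lte_lim => N M NM; apply: le_measure; rewrite ?inE//.
  exact/subsetPset/homoE.
rewrite (cvg_lim _ PE)// lte_fin => /(_ p1) [N _ /(_ N (leqnn N)) /= pN].
exists N; apply: le_trans pN _; apply: le_measure; rewrite ?inE//.
by move=> w; apply => /=.
Qed.

Lemma ou_process_hit (R : realType) (Omega : Type) (n m : nat)
    (W : R -> Omega -> 'cV[R]_m) (C : 'M[R]_(n, m)) (k r b : R)
    (x0 : 'cV[R]_n) (w : Omega) : 0 <= b -> r <= enorm x0 ->
  enorm (ou_process W C k x0 b w) < r ->
  exists2 t : R, 0 <= t <= b & enorm (ou_process W C k x0 t w) = r.
Proof.
move=> b0 rx0 Xr.
pose Y (t : R) := enorm (ou_process W C k x0 (Num.max t 0) w).
have cY : continuous Y.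
  move=> t; apply: (@continuous_comp _ _ _
    (fun t : R => ou_process W C k x0 (Num.max t 0) w) (@enorm R n)).
    exact: ou_process_continuous.
  exact: enorm_continuous.
have [|t] := @IVT R Y 0 b r b0 (continuous_subspaceT cY).
  rewrite /Y maxxx max_l// ou_process0 ge_min le_max rx0 (ltW Xr).
  by rewrite orbT.
rewrite in_itv/= => tb Yt; exists t => //.
by move: Yt; rewrite /Y max_l//; case/andP: tb.
Qed.

Lemma ou_process_hit_measurable (R : realType) (d : measure_display)
    (Omega : measurableType d) (P : probability Omega R)
    (F : R -> set (set Omega)) (n m : nat) (W : R -> Omega -> 'cV[R]_m)
    (C : 'M[R]_(n, m)) (k r b : R) (x0 : 'cV[R]_n) :
  usual_filtration P F -> brownian_motion P F W -> 0 <= b ->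
  measurable [set w | exists2 t : R, 0 <= t <= b &
                        enorm (ou_process W C k x0 t w) = r].
Proof.
move=> uF bW b0.
pose Y (t : R) (w : Omega) := enorm (ou_process W C k x0 (Num.max t 0) w) - r.
rewrite (_ : [set w | _] = [set w | exists2 t : R, 0 <= t <= b & Y t w = 0]).
  apply: measurable_ex_zero => // [w t|t t0].
    apply: cvgB; last exact: cvg_cst.
    apply: (@continuous_comp _ _ _
      (fun t : R => ou_process W C k x0 (Num.max t 0) w) (@enorm R n)).
      exact: ou_process_continuous.
    exact: enorm_continuous.
  apply: measurable_funB; last exact: measurable_cst.
  rewrite max_l//.
  apply: (@measurable_fun_borel _ _ _ R (ou_process W C k x0 t) (@enorm R n)).
    move=> S bS; apply: (usual_measurable uF t0).
    exact: (ou_process_adapted C k x0 uF bW t0 bS).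
  exact: enorm_continuous.
apply/seteqP; split=> w [t tb] H; exists t => //; move: H; rewrite /Y max_l//;
  try by case/andP: tb.
  by move=> ->; rewrite subrr.
by move=> /eqP; rewrite subr_eq0 => /eqP.
Qed.

Unset Implicit Arguments.
Set Strict Implicit.

Theorem theorem4p2 (R : realType) (d : measure_display)
    (Omega : measurableType d) (P : probability Omega R)
    (F : R -> set (set Omega)) (n m : nat) (W : R -> Omega -> 'cV[R]_m)
    (A B : 'M[R]_n) (C : 'M[R]_(n, m)) (delta Tmax p : R) :
  usual_filtration P F ->
  brownian_motion P F W ->
  \rank B = n ->
  (exists D : 'M[R]_n, hurwitz D /\ completely_disturbable D C) ->
  0 < delta -> 0 < Tmax -> 0 < p < 1 ->
  forall x0 : 'cV[R]_n, (~` eball0 n delta) x0 ->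
  exists u : R -> 'cV[R]_n -> 'cV[R]_n,
    admissible P F W A B C u /\
    forall X, closed_loop_solution P F W A B C u x0 X ->
      let hit := [set w | exists2 t, 0 <= t <= Tmax &
                          boundary (eball0 n delta) (X t w)] in
      measurable hit /\ (p%:E <= P hit)%E.
Proof.
move=> uF bW rB _ delta0 T0 /andP[p0 p1] x0 /negP; rewrite /= -leNgt => x0delta.
(* Integer gains give a sequence of events, as continuity of P along increasing sets requires. *)
pose X (N : nat) := ou_process W C N%:R x0.
pose inball N := [set w | enorm (X N Tmax w) < delta].
have mball N : measurable (inball N).
  apply: (usual_measurable uF (ltW T0)).
  apply: (ou_process_adapted C N%:R x0 uF bW (ltW T0)
    (S := [set x | enorm x < delta])).
  apply: sub_sigma_algebra.
  rewrite (_ : [set x | _] = @enorm R n @^-1` `]-oo, delta[); last first.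
    by apply/seteqP; split=> y; rewrite /= in_itv.
  by have /continuousP := @enorm_continuous R n; apply; exact: lray_open.
have [//||N pN] := @eventually_probability_ge _ _ _ P inball p p1.
  move=> w.
  have /cvgr_lt /(_ _ delta0) Xlt := @ou_process_cvg0 R Omega n m W C x0 Tmax w T0.
  exact: (cvgr_idn Xlt).
exists (feedback A B N%:R); split.
  split=> [S bS|y0]; first exact: feedback_borel.
  split; first by exists (ou_process W C N%:R y0); exact: ou_process_solution.
  by move=> Y Z; exact: closed_loop_unique.
move=> Y solY; set hit := [set w | _]; rewrite /=.
have solX := @ou_process_solution _ _ _ _ _ _ _ W A B C N%:R x0 uF bW rB.
have mhit := @ou_process_hit_measurable _ _ _ _ _ _ _ W C N%:R delta Tmax x0
  uF bW (ltW T0).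
(* Y is an arbitrary solution; almost surely it shares its paths, hence its hitting times, with the
   explicit process. *)
have [|mH ->] := @ae_measurable _ _ _ P _ hit (usual_complete uF) mhit.
  apply: filterS (closed_loop_unique rB solX solY) => w XY; split.
    move=> [t tT Xt]; exists t => //; rewrite -XY; last by case/andP: tT.
    exact/boundary_eball0.
  move=> [t tT /(boundary_eball0 _ delta0) Yt]; exists t => //.
  by rewrite XY//; case/andP: tT.
split=> //; apply: le_trans pN _; apply: le_measure; rewrite ?inE//.
by move=> w; exact: ou_process_hit (ltW T0) x0delta.
Qed.
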